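(* Let $m,n$ be positive integers, let $A\in\mathcal{L}(\mathcal{S}_n')$, let $a\in\mathcal{O}_M^{(m)}$, and let $v=(v_p)_{p\in\mathbb{R}^m}$ be a Schwartz family in $\mathcal{S}_n'$ which is $^{\mathcal{S}}$linearly independent and which is an $^{\mathcal{S}}$eigenfamily of $A$ with respect to the system of eigenvalues $a$ (so $A(v_p)=a(p)v_p$ for every $p\in\mathbb{R}^m$). Then for every tempered distribution $u$ in the $^{\mathcal{S}}$linear hull $^{\mathcal{S}}\mathrm{span}(v)$ one has $$A(u)=\int_{\mathbb{R}^m}(a\,[u|v])\,v ,$$ where $[u|v]\in\mathcal{S}_m'$ is the coordinate distribution of $u$ with respect to $v$.
   Context: Notation. $\mathcal{S}_n=\mathcal{S}(\mathbb{R}^n)$ is the Schwartz space of complex rapidly decreasing smooth functions on $\mathbb{R}^n$ and $\mathcal{S}_n'$ is its dual, the space of tempered distributions. $\mathcal{L}(\mathcal{S}_n')$ is the space of $^{\mathcal{S}}$linear endomorphisms of $\mathcal{S}_n'$, i.e. of linear maps $\mathcal{S}_n'\to\mathcal{S}_n'$ continuous for the weak* topology (equivalently, for the strong* topology). $\mathcal{O}_M^{(m)}$ is the space of complex smooth slowly increasing functions on $\mathbb{R}^m$ (smooth functions all of whose derivatives are polynomially bounded, i.e. the multipliers of $\mathcal{S}_m$); for $a\in\mathcal{O}_M^{(m)}$ and $w\in\mathcal{S}_m'$, the product $aw\in\mathcal{S}_m'$ is $(aw)(\psi)=w(a\psi)$. Schwartz families. A Schwartz family ($^{\mathcal{S}}$family)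 in $\mathcal{S}_n'$ indexed by $\mathbb{R}^m$ is a family $v=(v_p)_{p\in\mathbb{R}^m}$ of elements of $\mathcal{S}_n'$ such that for every $\phi\in\mathcal{S}_n$ the function $\widehat v(\phi):\mathbb{R}^m\to\mathbb{C}$, $p\mapsto v_p(\phi)$, belongs to $\mathcal{S}_m$. The set of these families is $\mathcal{S}(\mathbb{R}^m,\mathcal{S}_n')$. Superpositions. For $w\in\mathcal{S}_m'$ and $v\in\mathcal{S}(\mathbb{R}^m,\mathcal{S}_n')$, the superposition $\int_{\mathbb{R}^m}w\,v\in\mathcal{S}_n'$ is defined by $\left(\int_{\mathbb{R}^m}w\,v\right)(\phi)=w(\widehat v(\phi))$ for $\phi\in\mathcal{S}_n$. The $^{\mathcal{S}}$linear hull $^{\mathcal{S}}\mathrm{span}(v)$ is the set of all superpositions $\int_{\mathbb{R}^m}w\,v$ with $w\in\mathcal{S}_m'$. The family $v$ is $^{\mathcal{S}}$linearly independent if $w\in\mathcal{S}_m'$ and $\int_{\mathbb{R}^m}w\,v=0$ imply $w=0$. If $v$ is $^{\mathcal{S}}$linearly independent and $u\in{}^{\mathcal{S}}\mathrm{span}(v)$, the coordinate distribution $[u|v]$ is the unique $w\in\mathcal{S}_m'$ with $u=\int_{\mathbb{R}^m}w\,v$. Eigenfamilies. Given $A\in\mathcal{L}(\mathcal{S}_n')$, $a\in\mathcal{O}_M^{(m)}$ and $v\in\mathcal{S}(\mathbb{R}^m,\mathcal{S}_n')$, $v$ is an $^{\mathcal{S}}$eigenfamily of $A$ with respect to the system of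 eigenvalues $a$ if $A(v_p)=a(p)v_p$ for every $p\in\mathbb{R}^m$. *)

(* Defs.v *)
From HB Require Import structures.
From mathcomp Require Import all_boot all_order all_algebra.
From mathcomp Require Import complex ring.
From mathcomp Require Import all_classical all_reals all_analysis.
Set Implicit Arguments.
Unset Strict Implicit.
Unset Printing Implicit Defensive.
Import Order.TTheory GRing.Theory Num.Theory.
Import numFieldNormedType.Exports.
Local Open Scope classical_set_scope.
Local Open Scope ring_scope.
Local Open Scope complex_scope.

Local Notation Re := (@complex.Re _).
Local Notation Im := (@complex.Im _).

(* The usual topology and norm of the complex numbers R[i]. *)
HB.instance Definition _ (R : realType) := NormedModule.copy R[i] R[i]^o.

Section Derivatives.
Context {R : realType} {n : nat}.
Implicit Types (f g : 'rV[R]_n -> R[i]) (x : 'rV[R]_n) (s : seq 'I_n).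

(* Complex-valued functions of real variables are differentiated
   componentwise: d_j (u + i v) = d_j u + i d_j v. *)
Definition partial (j : 'I_n) f : 'rV[R]_n -> R[i] :=
  fun x => 'D_('e_j) (Re \o f) x +i* 'D_('e_j) (Im \o f) x.

Definition partially_derivable f :=
  forall (j : 'I_n) x, derivable (Re \o f) x 'e_j /\
                       derivable (Im \o f) x 'e_j.

(* The iterated partial derivative in the successive directions listed in s
   (the last one being applied first); every multi-index derivative is of this
   form, and by Schwarz's theorem the order is irrelevant on smooth
   functions. *)
Definition partials s f : 'rV[R]_n -> R[i] := foldr partial f s.

Definition smooth f :=
  forall s, continuous (partials s f) /\ partially_derivable (partials s f).

(* `|x| is the sup norm of R^n; equivalent norms give the same notions of
   rapid decrease and of polynomial growth. *)
Definition weight (k : nat) x : R := (1 + `|x|) ^+ k.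

Definition weighted_partials (k : nat) s f : 'rV[R]_n -> R[i] :=
  fun x => (weight k x)%:C * partials s f x.

Definition is_schwartz f :=
  smooth f /\ forall k s, exists M : R,
    forall x, `|weighted_partials k s f x| <= M%:C.

Definition is_slowly_increasing f :=
  smooth f /\ forall s, exists k (M : R),
    forall x, `|partials s f x| <= (M * weight k x)%:C.

Lemma weight_ge1 k x : 1 <= weight k x.
Proof. by rewrite exprn_ege1 // lerDl. Qed.

Lemma weight_ge0 k x : 0 <= weight k x.
Proof. exact: le_trans (weight_ge1 k x). Qed.

Lemma weightD k l x : weight (k + l) x = weight k x * weight l x.
Proof. exact: exprD. Qed.

Lemma Re_add f g : Re \o (f + g) = Re \o f + (Re \o g).
Proof. by apply/funext => x; rewrite /= !fctE raddfD. Qed.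

Lemma Im_add f g : Im \o (f + g) = Im \o f + (Im \o g).
Proof. by apply/funext => x; rewrite /= !fctE raddfD. Qed.

Lemma Re_mul f g : Re \o (f * g) =
  (Re \o f) * (Re \o g) - (Im \o f) * (Im \o g).
Proof. by apply/funext => x; rewrite /= !fctE; case: (f x) (g x) => a b []. Qed.

Lemma Im_mul f g : Im \o (f * g) =
  (Re \o f) * (Im \o g) + (Im \o f) * (Re \o g).
Proof. by apply/funext => x; rewrite /= !fctE; case: (f x) (g x) => a b []. Qed.

Lemma partially_derivableD f g : partially_derivable f ->
  partially_derivable g -> partially_derivable (f + g).
Proof.
move=> df dg j x; have [? ?] := df j x; have [? ?] := dg j x.
by rewrite Re_add Im_add; split; apply: derivableD.
Qed.

Lemma partially_derivableM f g : partially_derivable f ->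
  partially_derivable g -> partially_derivable (f * g).
Proof.
move=> df dg j x; have [d1 d2] := df j x; have [d3 d4] := dg j x.
rewrite Re_mul Im_mul; split.
  exact: (derivableB (derivableM d1 d3) (derivableM d2 d4)).
exact: (derivableD (derivableM d1 d4) (derivableM d2 d3)).
Qed.

Lemma partialD j f g : partially_derivable f -> partially_derivable g ->
  partial j (f + g) = partial j f + partial j g.
Proof.
move=> df dg; apply/funext => x; have [? ?] := df j x; have [? ?] := dg j x.
by rewrite /partial Re_add Im_add !deriveD// fctE.
Qed.

Lemma partialM j f g : partially_derivable f -> partially_derivable g ->
  partial j (f * g) = partial j f * g + f * partial j g.
Proof.
move=> df dg; apply/funext => x.
have [d1 d2] := df j x; have [d3 d4] := dg j x.
rewrite /partial Re_mul Im_mul.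
rewrite (deriveB (derivableM d1 d3) (derivableM d2 d4)).
rewrite (deriveD (derivableM d1 d4) (derivableM d2 d3)).
rewrite (deriveM d1 d3) (deriveM d2 d4) (deriveM d1 d4) (deriveM d2 d3).
rewrite !fctE /=.
move: ('D_'e_j _ _ : R) ('D_'e_j _ _ : R) ('D_'e_j _ _ : R) ('D_'e_j _ _ : R).
move=> a' b' c' d'; case: (f x) (g x) => a b [c d] /=.
by rewrite /GRing.scale; simpc; congr Complex => /=; ring.
Qed.

Lemma partially_derivable_cst (c : R[i]) : partially_derivable (cst c).
Proof. by move=> j x; split; apply: derivable_cst. Qed.

Lemma partial_cst j (c : R[i]) : partial j (cst c) = cst 0.
Proof.
apply/funext => x; rewrite /partial.
rewrite (_ : Re \o cst c = cst (Re c))//.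
rewrite (_ : Im \o cst c = cst (Im c))//.
by rewrite !derive_cst.
Qed.

Lemma smooth_cst (c : R[i]) : smooth (cst c).
Proof.
move=> s; suff [d ->] : exists d, partials s (cst c) = cst d.
  by split; [exact: cst_continuous | exact: partially_derivable_cst].
elim: s => [|j s [d IH]]; first by exists c.
by exists 0; rewrite /= IH partial_cst.
Qed.

Lemma partials_cst0 s : partials s (cst 0) = cst 0.
Proof. by elim: s => //= j s ->; rewrite partial_cst. Qed.

(* The ways of distributing the directions of s between two factors, indexing
   the terms of the Leibniz formula. *)
Fixpoint splits (T : Type) (s : seq T) : seq (seq T * seq T) :=
  if s is j :: s' then
    [seq (j :: p.1, p.2) | p <- splits s'] ++
    [seq (p.1, j :: p.2) | p <- splits s']
  else [:: ([::], [::])].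

Lemma partialsD s f g : smooth f -> smooth g ->
  partials s (f + g) = partials s f + partials s g.
Proof.
move=> sf sg; elim: s => //= j s ->.
by rewrite partialD//; [case: (sf s)|case: (sg s)].
Qed.

Lemma smoothD f g : smooth f -> smooth g -> smooth (f + g).
Proof.
move=> sf sg s; rewrite partialsD//; have [cf df] := sf s; have [cg dg] := sg s.
split; last exact: partially_derivableD.
by move=> x; exact: (continuousD (cf x) (cg x)).
Qed.

Lemma partially_derivable_sum (I : Type) (r : seq I)
    (F : I -> 'rV[R]_n -> R[i]) :
  (forall i, partially_derivable (F i)) ->
  partially_derivable (\sum_(i <- r) F i).
Proof.
move=> dF; elim: r => [|i r IH].
  by rewrite big_nil; exact: (partially_derivable_cst 0).
by rewrite big_cons; exact: (partially_derivableD (dF i) IH).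
Qed.

Lemma partial_sum j (I : Type) (r : seq I) (F : I -> 'rV[R]_n -> R[i]) :
  (forall i, partially_derivable (F i)) ->
  partial j (\sum_(i <- r) F i) = \sum_(i <- r) partial j (F i).
Proof.
move=> dF; elim: r => [|i r IH]; first by rewrite !big_nil partial_cst.
by rewrite !big_cons partialD ?IH//; exact: partially_derivable_sum.
Qed.

Lemma partialsM s f g : smooth f -> smooth g ->
  partials s (f * g) = \sum_(p <- splits s) partials p.1 f * partials p.2 g.
Proof.
move=> sf sg; elim: s => [|j s IH] /=; first by rewrite big_seq1.
have df t : partially_derivable (partials t f) by case: (sf t).
have dg t : partially_derivable (partials t g) by case: (sg t).
rewrite IH partial_sum; last by move=> p; exact: partially_derivableM.
transitivity (\sum_(p <- splits s)
    (partial j (partials p.1 f) * partials p.2 g +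
     partials p.1 f * partial j (partials p.2 g))).
  by apply: eq_bigr => p _; exact: partialM.
by rewrite big_cat !big_map big_split.
Qed.

Lemma smoothM f g : smooth f -> smooth g -> smooth (f * g).
Proof.
move=> sf sg s; rewrite partialsM//; split; last first.
  apply: partially_derivable_sum => p; apply: partially_derivableM.
    by case: (sf p.1).
  by case: (sg p.2).
elim: (splits s) => [|p r IH].
  by rewrite big_nil; exact: (@cst_continuous _ _ 0).
rewrite big_cons => x.
exact: (continuousD (continuousM ((sf p.1).1 x) ((sg p.2).1 x)) (IH x)).
Qed.

Lemma cmul_fctE (c : R[i]) f : c *: f = cst c * f.
Proof. by apply/funext => x; rewrite !fctE. Qed.

Lemma smoothZ (c : R[i]) f : smooth f -> smooth (c *: f).
Proof.
by move=> sf; rewrite cmul_fctE; exact: (smoothM (smooth_cst c) sf).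
Qed.

Lemma partialsZ s (c : R[i]) f : smooth f ->
  partials s (c *: f) = c *: partials s f.
Proof.
move=> sf; elim: s => //= j s ->.
rewrite !cmul_fctE partialM ?partial_cst; first by rewrite mul0r add0r.
  exact: partially_derivable_cst.
by case: (sf s).
Qed.

Lemma weighted_partialsD k s f g : smooth f -> smooth g ->
  weighted_partials k s (f + g) =
  weighted_partials k s f + weighted_partials k s g.
Proof.
move=> sf sg; apply/funext => x.
by rewrite /weighted_partials partialsD//= !fctE mulrDr.
Qed.

Lemma weighted_partialsZ k s c f : smooth f ->
  weighted_partials k s (c *: f) = c *: weighted_partials k s f.
Proof.
move=> sf; apply/funext => x; rewrite /weighted_partials partialsZ//= !fctE.
by rewrite /GRing.scale /= mulrCA.
Qed.

Lemma weighted_partialsM_le a k s : is_slowly_increasing a ->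
  exists L : seq (nat * seq 'I_n * R), forall g, smooth g -> forall x,
    `|weighted_partials k s (a * g) x| <=
       \sum_(q <- L) (q.2)%:C * `|weighted_partials q.1.1 q.1.2 g x|.
Proof.
move=> [sa ba].
have /choice[K KP] : forall t, exists q : nat * R, forall x,
    `|partials t a x| <= (q.2 * weight q.1 x)%:C.
  by move=> t; have [l [M HM]] := ba t; exists (l, M).
exists [seq ((k + (K p.1).1)%N, p.2, (K p.1).2) | p <- splits s] => g sg x.
rewrite big_map /weighted_partials partialsM// fct_sumE mulr_sumr.
apply: le_trans (ler_norm_sum _ _ _) _; apply: ler_sum => p _ /=.
rewrite weightD rmorphM /= !normrM.
have w0 : 0 <= (weight (K p.1).1 x)%:C by rewrite lecR weight_ge0.
rewrite (ger0_norm w0).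
rewrite [leRHS](_ : _ = `|(weight k x)%:C| *
    (((K p.1).2 * weight (K p.1).1 x)%:C * `|partials p.2 g x|)); last first.
  by rewrite rmorphM /=; ring.
by rewrite ler_wpM2l// ler_wpM2r.
Qed.

Lemma is_schwartzM a f : is_slowly_increasing a -> is_schwartz f ->
  is_schwartz (a * f).
Proof.
move=> ia [sf bf]; split; first by apply: smoothM => //; case: ia.
move=> k s; have [L HL] := weighted_partialsM_le k s ia.
suff [M HM] : exists M : R, forall x, \sum_(q <- L) (q.2)%:C *
    `|weighted_partials q.1.1 q.1.2 f x| <= M%:C.
  by exists M => x; apply: le_trans (HL _ sf x) (HM x).
elim: L {HL} => [|q L [M IH]]; first by exists 0 => x; rewrite big_nil.
have [M' HM'] := bf q.1.1 q.1.2.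
exists (`|q.2| * M' + M) => x; rewrite big_cons rmorphD /= lerD//.
apply: (@le_trans _ _ ((`|q.2|)%:C * `|weighted_partials q.1.1 q.1.2 f x|)).
  by apply: ler_wpM2r => //; rewrite lecR ler_norm.
by rewrite rmorphM; apply: ler_wpM2l => //; rewrite lecR.
Qed.

Definition schwartz_pred : {pred 'rV[R]_n -> R[i]} :=
  fun f => `[< is_schwartz f >].

Lemma schwartz_submod_closed : submod_closed schwartz_pred.
Proof.
split.
  apply/asboolP; split; first exact: (smooth_cst 0).
  move=> k s; exists 0 => x.
  by rewrite /weighted_partials (partials_cst0 s) mulr0 normr0.
move=> c f g /asboolP[sf bf] /asboolP[sg bg]; apply/asboolP.
have sc := smoothZ c sf.
split; first exact: smoothD.
move=> k s; have [M HM] := bf k s; have [M' HM'] := bg k s.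
exists (Re `|c| * M + M') => x.
rewrite weighted_partialsD// weighted_partialsZ// !fctE rmorphD rmorphM /=.
apply: le_trans (ler_normD _ _) _; apply: lerD => //.
rewrite normrM (_ : (Re `|c|)%:C = `|c|) ?ler_wpM2l//.
Qed.

HB.instance Definition _ := GRing.isSubmodClosed.Build _ _ schwartz_pred
  schwartz_submod_closed.

End Derivatives.

Record schwartz (R : realType) (n : nat) := Schwartz {
  schwartz_fun :> 'rV[R]_n -> R[i];
  schwartzP : schwartz_fun \in schwartz_pred }.

HB.instance Definition _ R n := [isSub for @schwartz_fun R n].
HB.instance Definition _ R n := [Choice of schwartz R n by <:].
HB.instance Definition _ R n :=
  [SubChoice_isSubLmodule of schwartz R n by <:].

(* The Schwartz topology is the one generated by the seminorms
   sup_x (1 + |x|)^k |d_s phi(x)|, i.e. the coarsest topology making each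
   phi |-> (1 + |x|)^k d_s phi continuous for uniform convergence. *)
Definition schwartz_topology (R : realType) (n : nat) : Type :=
  sup_topology (fun ks : nat * seq 'I_n => Topological.class
    (initial_topology (fun phi : schwartz R n =>
      (weighted_partials ks.1 ks.2 phi : {uniform 'rV[R]_n -> R[i]})))).

HB.instance Definition _ (R : realType) (n : nat) :=
  Topological.copy (schwartz R n) (schwartz_topology R n).

Section Tempered.
Context {R : realType} {n : nat}.

Definition tempered_pred : {pred schwartz R n -> R[i]} :=
  fun u => `[< linear u /\ continuous u >].

Lemma tempered_submod_closed : submod_closed tempered_pred.
Proof.
split.
  apply/asboolP; split; last exact: (@cst_continuous _ _ (0 : R[i])).
  by move=> c phi psi; rewrite -[RHS]/(c *: (0 : R[i]) + 0) scaler0 addr0.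
move=> c u v /asboolP[lu cu] /asboolP[lv cv]; apply/asboolP; split.
  move=> d phi psi; rewrite !fctE lu lv.
  by rewrite /GRing.scale /=; ring.
by move=> phi; exact: (continuousD (cvgZl_tmp (k := c) (cu phi)) (cv phi)).
Qed.

HB.instance Definition _ := GRing.isSubmodClosed.Build _ _ tempered_pred
  tempered_submod_closed.

End Tempered.

Record tempered (R : realType) (n : nat) := Tempered {
  tempered_fun :> schwartz R n -> R[i];
  temperedP : tempered_fun \in tempered_pred }.

HB.instance Definition _ R n := [isSub for @tempered_fun R n].
HB.instance Definition _ R n := [Choice of tempered R n by <:].
HB.instance Definition _ R n :=
  [SubChoice_isSubLmodule of tempered R n by <:].

(* S'_n carries the weak* topology, that of pointwise convergence on S_n. *)
HB.instance Definition _ (R : realType) (n : nat) :=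
  Topological.copy (tempered R n) (initial_topology
    (fun u : tempered R n => (tempered_fun u : {ptws schwartz R n -> R[i]}))).

Record slowly_increasing (R : realType) (n : nat) := SlowlyIncreasing {
  slowly_increasing_fun :> 'rV[R]_n -> R[i];
  slowly_increasingP : is_slowly_increasing slowly_increasing_fun }.

Section Multiplication.
Context {R : realType} {n : nat}.
Implicit Types (a : slowly_increasing R n) (phi psi : schwartz R n).

Lemma mul_schwartz_subproof a psi :
  (fun x => a x * psi x) \in schwartz_pred.
Proof.
have /asboolP ps := schwartzP psi.
by apply/asboolP; exact: (is_schwartzM (slowly_increasingP a) ps).
Qed.

Definition mul_schwartz a psi : schwartz R n :=
  Schwartz (mul_schwartz_subproof a psi).

Lemma weighted_partialsB k s psi phi x : weighted_partials k s (psi - phi) x =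
  weighted_partials k s psi x - weighted_partials k s phi x.
Proof.
have /asboolP[spsi _] := schwartzP psi; have /asboolP[sphi _] := schwartzP phi.
rewrite -[schwartz_fun (psi - phi)]/(schwartz_fun psi - schwartz_fun phi).
rewrite -scaleN1r weighted_partialsD//; last exact: smoothZ.
by rewrite weighted_partialsZ// !fctE scaleN1r.
Qed.

Lemma initial_cvgP (S : choiceType) (T : topologicalType) (h : S -> T)
    (F : set_system S) (s : S) : Filter F ->
  F --> (s : initial_topology h) <-> h @ F --> h s.
Proof.
move=> FF; split=> [Fs|Fs A].
  by move=> A hA; apply: Fs; exact: (@initial_continuous _ _ h s A hA).
rewrite nbhsE => -[_ [[B oB <-] Bs] sBA].
by apply: filterS sBA _; apply: Fs; exact: open_nbhs_nbhs.
Qed.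

Lemma schwartz_cvgP (F : set_system (schwartz R n)) phi : Filter F ->
  F --> phi <->
  forall k s (e : R[i]), 0 < e -> \forall psi \near F, forall x,
    `|weighted_partials k s (psi - phi) x| < e.
Proof.
move=> FF; split=> [/cvg_sup Fphi k s e e0|Fphi].
  have /initial_cvgP := Fphi (k, s).
  move=> /(_ [set h | forall x, ball (weighted_partials k s phi x) e (h x)]).
  have nU : nbhs (weighted_partials k s phi : {uniform 'rV[R]_n -> R[i]})
      [set h | forall x, ball (weighted_partials k s phi x) e (h x)].
    apply/uniform_nbhs; exists [set xy | ball xy.1 e xy.2].
    split; first by rewrite -entourage_ballE; exists e.
    by move=> h + x; apply.
  move=> /(_ nU) Fn; apply: (@filterS _ F FF _ _ _ Fn) => psi /= H x.
  by rewrite weighted_partialsB distrC; have := H x; rewrite -ball_normE.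
apply/cvg_sup => -[k s]; apply/initial_cvgP => P /uniform_nbhs[E [entE]].
have [e e0 eE] : exists2 e : R[i], 0 < e & [set xy | ball xy.1 e xy.2] `<=` E.
  by move: entE; rewrite -entourage_ballE => -[e e0 eE]; exists e.
move=> EP; apply: filterS (Fphi k s e e0) => psi H.
apply: EP => x _; apply: eE; rewrite -ball_normE /= distrC.
by rewrite -weighted_partialsB.
Qed.

Lemma mul_schwartzB a psi phi :
  mul_schwartz a psi - mul_schwartz a phi = mul_schwartz a (psi - phi).
Proof. by apply/val_inj/funext => x; rewrite /= !fctE mulrBr. Qed.

Lemma mul_schwartz_continuous a : continuous (mul_schwartz a).
Proof.
move=> phi.
have Fphi : Filter (nbhs phi) by exact: nbhs_filter.
have FF : Filter (mul_schwartz a @ phi) := fmap_filter _ Fphi.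
apply/(schwartz_cvgP _ FF) => k s e e0.
have [L HL] := weighted_partialsM_le k s (slowly_increasingP a).
change (\forall psi \near phi, forall x,
  `|weighted_partials k s (mul_schwartz a psi - mul_schwartz a phi) x| < e).
suff : \forall psi \near phi, forall x, \sum_(q <- L) (q.2)%:C *
    `|weighted_partials q.1.1 q.1.2 (psi - phi) x| < e.
  apply: filterS => psi H x; rewrite mul_schwartzB.
  apply: le_lt_trans (H x); apply: HL.
  by have /asboolP[] := schwartzP (psi - phi).
elim: L {HL} e e0 => [|q L IH] e e0.
  by apply: filterE => psi x; rewrite big_nil.
have e2 : 0 < e / 2 by rewrite divr_gt0.
have c0 : 0 < (`|q.2| + 1)%:C by rewrite ltcR ltr_wpDl.
have eq0 : 0 < e / 2 / (`|q.2| + 1)%:C by rewrite divr_gt0.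
have /(schwartz_cvgP _ Fphi)/(_ q.1.1 q.1.2 _ eq0) := @cvg_id _ (nbhs phi).
apply: filterS2 (IH _ e2) => psi HL Hq x; rewrite big_cons (splitr e).
rewrite ltrD//; apply: le_lt_trans.
  apply: (@ler_wpM2r _ _ _ (q.2)%:C (`|q.2| + 1)%:C) => //.
  by rewrite lecR (le_trans (ler_norm _))// lerDl.
by rewrite mulrC -ltr_pdivlMr.
Qed.

Lemma mul_tempered_subproof a (w : tempered R n) :
  (fun psi => w (mul_schwartz a psi)) \in tempered_pred.
Proof.
have /asboolP[lw cw] := temperedP w.
apply/asboolP; split.
  move=> c phi psi; rewrite -lw; congr (tempered_fun w _).
  by apply/val_inj/funext => x; rewrite /= !fctE mulrDr mulrCA.
move=> phi; apply: continuous_comp; last exact: cw.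
exact: mul_schwartz_continuous.
Qed.

Definition mul_tempered a (w : tempered R n) : tempered R n :=
  Tempered (mul_tempered_subproof a w).

End Multiplication.

Record schwartz_family (R : realType) (m n : nat) := SchwartzFamily {
  family_fun :> 'rV[R]_m -> tempered R n;
  family_fun_schwartz : forall phi : schwartz R n,
    (fun p => family_fun p phi) \in schwartz_pred }.

Section Superposition.
Context {R : realType} {m n : nat}.
Implicit Types (v : schwartz_family R m n) (w : tempered R m).

Definition family_hat v (phi : schwartz R n) : schwartz R m :=
  Schwartz (family_fun_schwartz v phi).

(* The superposition of v with respect to w, as a functional on S_n. It is
   always continuous (a consequence of the Banach-Steinhaus theorem for the
   Frechet space S_n), hence a tempered distribution; here it is compared with
   elements of S'_n through their underlying functionals. *)
Definition superposition w v : schwartz R n -> R[i] :=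
  fun phi => w (family_hat v phi).

Definition Sspan v : set (tempered R n) :=
  [set u | exists w, tempered_fun u = superposition w v].

Definition Slinearly_independent v :=
  forall w, superposition w v = 0 -> w = 0.

(* The coordinate distribution [u|v]; meaningful when v is S-linearly
   independent and u lies in Sspan v, see coordinatesP. *)
Definition coordinates (u : tempered R n) v : tempered R m :=
  xget 0 [set w | tempered_fun u = superposition w v].

Lemma coordinatesP v u : Slinearly_independent v -> Sspan v u ->
  forall w, tempered_fun u = superposition w v <-> w = coordinates u v.
Proof.
move=> vfree uv.
have uE : tempered_fun u = superposition (coordinates u v) v.
  exact: (xgetPex (P := [set w | tempered_fun u = superposition w v]) 0 uv).
move=> w; split=> [uw|->//].
apply/eqP; rewrite -subr_eq0; apply/eqP/vfree/funext => phi.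
rewrite -[LHS]/(superposition w v phi - superposition (coordinates u v) v phi).
by rewrite -uw -uE subrr.
Qed.

Definition Seigenfamily (A : tempered R n -> tempered R n)
    (a : slowly_increasing R m) v :=
  forall p, A (v p) = a p *: v p.

End Superposition.

(* Main.v *)
Require Import Defs.
From HB Require Import structures.
From mathcomp Require Import all_boot all_order all_algebra.
From mathcomp Require Import complex ring.
From mathcomp Require Import all_classical all_reals all_analysis.
Set Implicit Arguments.
Unset Strict Implicit.
Unset Printing Implicit Defensive.
Import Order.TTheory GRing.Theory Num.Theory.
Import numFieldNormedType.Exports.
Local Open Scope classical_set_scope.
Local Open Scope ring_scope.
Local Open Scope complex_scope.

(* The transpose of the weak*-continuous operator A maps S_n to itself, because
   a weak*-continuous linear functional on S'_n is evaluation at some test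
   function: for every phi there is psi with (A u)(phi) = u(psi) for all u.
   Applied to u = v_p this reads psi^(p) = a(p) phi^(p), where ^ is the hat of
   the family v; applied to u = int w v it gives
   (A u)(phi) = w(psi^) = w(a phi^) = (a w)(phi^). *)

(* Induction on the number of functionals: a vector [u0] killed by [G] but not
   by [g q] allows a multiple of [g q] to be subtracted from [f]. *)
Lemma scalar_lin_comb (F : fieldType) (V : lmodType F) (I : eqType)
    (g : I -> V -> F) (G : seq I) (f : V -> F) :
  (forall q, scalar (g q)) -> scalar f ->
  (forall u, {in G, forall q, g q u = 0} -> f u = 0) ->
  exists L : seq (F * I), forall u, f u = \sum_(p <- L) p.1 * g p.2 u.
Proof.
move=> lg; elim: G f => [|q G IH] f lf fG.
  by exists [::] => u; rewrite big_nil; apply: fG.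
have [[u0 u0G gu0]|H] :=
    pselect (exists2 u0, {in G, forall q', g q' u0 = 0} & g q u0 != 0).
  pose c := f u0 / g q u0.
  have [||L HL] := IH (fun u => f u - c * g q u).
  - by move=> b u v; rewrite lf lg; ring.
  (* With this [d], [d *: u0 + u] is killed by [g q] as well as by [G], and the value of [f] there
     is exactly [f u - c * g q u]. *)
  - move=> u uG; pose d := - g q u / g q u0.
    have : f (d *: u0 + u) = 0.
      apply: fG => q'; rewrite inE => /predU1P[->|q'G].
        by rewrite lg divfK// addNr.
      by rewrite lg u0G// uG// mulr0 addr0.
    by rewrite lf => <-; rewrite /c /d; ring.
  exists ((c, q) :: L) => u.
  by rewrite big_cons -HL /= addrC subrK.
apply: IH => // u uG; apply: fG => q'; rewrite inE => /predU1P[->|/uG//].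
by apply: contrapT => /eqP gu; apply: H; exists u.
Qed.

Section WeakStar.
Context {R : realType} {n : nat}.
Implicit Types (phi psi : schwartz R n).

Lemma weak_star_cvgP (F : set_system (tempered R n)) (u : tempered R n) :
  Filter F ->
  F --> u <-> forall phi, (fun w : tempered R n => w phi) @ F --> u phi.
Proof.
move=> FF; apply: (iff_trans (initial_cvgP _ _ FF)).
exact: pointwise_cvgP.
Qed.

Lemma tempered_eval_continuous phi :
  continuous (fun u : tempered R n => u phi).
Proof. by move=> u; have /weak_star_cvgP := @cvg_id _ (nbhs u); apply. Qed.

(* The finite intersections of kernels of evaluations form a filter base
   converging to 0, so [f] is bounded, hence zero, on one of them. *)
Lemma weak_star_functionalP (f : tempered R n -> R[i]) :
  scalar f -> continuous f -> exists psi, forall u, f u = u psi.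
Proof.
move=> lf cf.
have f0 : f 0 = 0.
  by have := lf (-1) 0 0; rewrite scaleN1r oppr0 addr0 mulN1r addNr.
pose K (s : seq (schwartz R n)) : set (tempered R n) :=
  [set u | {in s, forall phi, u phi = 0}].
have FK : Filter (filter_from setT K).
  apply: filter_fromT_filter; first by exists [::].
  move=> s t; exists (s ++ t) => u Ku.
  by split=> phi phis; apply: Ku; rewrite mem_cat phis ?orbT.
have K0 : filter_from setT K --> (0 : tempered R n).
  apply/weak_star_cvgP => phi A A0; exists [:: phi] => // u Ku /=.
  by rewrite (Ku phi) ?mem_head//; exact: nbhs_singleton.
have : f @ filter_from setT K --> f 0 by apply: cvg_comp K0 (cf 0).
rewrite f0 => /cvgr0Pnorm_lt/(_ 1 ltr01)[s _ sf].
have [|u uK|L HL] :=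
    @scalar_lin_comb _ _ _ (fun phi (u : tempered R n) => u phi) s f _ lf.
- by [].
- apply: contrapT => /eqP fu0.
  (* [K s] is a subspace: were [f u] nonzero, rescaling [u] to give [f] the value 1 would stay
     inside it, against the bound [|f| < 1] there. *)
  have /sf /= : K s ((f u)^-1 *: u + 0).
    move=> phi phis; rewrite addr0.
    by rewrite -[LHS]/(_ * u phi) [u phi]uK// mulr0.
  by rewrite lf f0 addr0 mulVf// normr1 ltxx.
(* Each [u] is linear, so a combination of evaluations is one evaluation at the combined test
   function. *)
exists (\sum_(p <- L) p.1 *: p.2) => u; rewrite HL.
have /asboolP[lu _] := temperedP u.
elim: L {HL} => [|p L IH]; rewrite ?big_nil ?big_cons.
  by have := lu (-1) 0 0; rewrite !scaleN1r oppr0 addr0 addNr.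
by rewrite IH lu.
Qed.

End WeakStar.

Theorem mainTheorem1 (R : realType) (m n : nat)
    (m_gt0 : (0 < m)%N) (n_gt0 : (0 < n)%N)
    (A : {linear tempered R n -> tempered R n}) (A_cont : continuous A)
    (a : slowly_increasing R m) (v : schwartz_family R m n)
    (v_free : Slinearly_independent v) (v_eigen : Seigenfamily A a v)
    (u : tempered R n) (u_span : Sspan v u) :
  tempered_fun (A u) = superposition (mul_tempered a (coordinates u v)) v.
Proof.
have /(coordinatesP v_free u_span) uE := erefl (coordinates u v).
apply/funext => phi.
have [||psi psiE] := @weak_star_functionalP _ _ (fun w => A w phi).
- by move=> b w w'; rewrite linearP.
- move=> w; apply: (@continuous_comp _ _ _ A (fun w : tempered R n => w phi)).
    exact: A_cont.
  exact: tempered_eval_continuous.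
rewrite psiE uE /superposition; congr (tempered_fun _ _).
by apply/val_inj/funext => p; rewrite /= -psiE v_eigen.
Qed.
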